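(* For all positive integers $n$ and all $\varepsilon\in(0,1/2)$, there exists a one-way entanglement-assisted protocol for $\mathsf{EQ}_n$ with error probability at most $\varepsilon$ using $\lceil\log(1/\varepsilon)\rceil+1$ classical bits of communication and $\lceil\log(\sqrt{n}/\varepsilon)\rceil+4$ shared EPR-pairs.
   Context: All logarithms are base 2. $\mathsf{EQ}_n:\{0,1\}^n\times\{0,1\}^n\to\{0,1\}$ is the Equality function: $\mathsf{EQ}_n(x,y)=1$ iff $x=y$. In a one-way entanglement-assisted protocol using $k$ EPR-pairs and $m$ bits of communication, Alice (holding $x\in\{0,1\}^n$) and Bob (holding $y\in\{0,1\}^n$) initially share the input-independent state $\frac{1}{\sqrt{2^k}}\sum_{i\in\{0,1\}^k}|i\rangle_A|i\rangle_B$. Alice performs a measurement, depending on $x$, on her part and sends an $m$-bit classical string determined by her outcome to Bob. Bob then performs a measurement, depending on $y$ and on the received message, on his part and outputs a bit. The protocol has error probability at most $\varepsilon$ if for every $(x,y)$ the probability that the output differs from $\mathsf{EQ}_n(x,y)$ is at most $\varepsilon$. *)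

(* Defs.v *)
From HB Require Import structures.
From mathcomp Require Import all_boot all_order all_algebra.
From mathcomp Require Import all_classical all_reals all_analysis.
From mathcomp Require Import complex mxtens.

Set Implicit Arguments.
Unset Strict Implicit.
Unset Printing Implicit Defensive.

Import Order.TTheory GRing.Theory Num.Theory.

Local Open Scope ring_scope.
Local Open Scope complex_scope.

Definition log2 (R : realType) (x : R) : R := ln x / ln 2.

Notation bits n := (n.-tuple bool).

Definition EQ (n : nat) (x y : bits n) : bool := x == y.

Section Quantum.
Variable R : realType.

Definition adj (p q : nat) (A : 'M[R[i]]_(p, q)) : 'M[R[i]]_(q, p) :=
  map_mx (fun z : R[i] => z^*)%R A^T.

(* In R[i], 0 <= z means that z is real and nonnegative, so this also forces A
   to be Hermitian. *)
Definition psd (d : nat) (A : 'M[R[i]]_d) : Prop :=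
  forall v : 'cV[R[i]]_d, 0 <= (adj v *m A *m v) 0 0.

Record measurement (O : finType) (d : nat) := Measurement {
  effect : O -> 'M[R[i]]_d;
  effect_psd : forall o, psd (effect o);
  effect_sum : \sum_o effect o = 1%:M
}.

Definition ket (d : nat) (i : 'I_d) : 'cV[R[i]]_d := delta_mx i 0.

(* The basis label i of {0,1}^k is encoded as an element of 'I_(2 ^ k).
   The first tensor factor belongs to Alice, the second one to Bob. *)
Definition epr (k : nat) : 'cV[R[i]]_(2 ^ k * 2 ^ k) :=
  ((Num.sqrt (2 ^+ k) : R)^-1)%:C *: \sum_(i < 2 ^ k) (ket i *t ket i).

(* Born rule for the joint outcome with local effects E (Alice) and F (Bob);
   the complex value is real and nonnegative when E and F are. *)
Definition joint_prob (k : nat) (E F : 'M[R[i]]_(2 ^ k)) : R :=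
  complex.Re ((adj (epr k) *m (E *t F) *m epr k) 0 0).

Record protocol (n k m : nat) := Protocol {
  alice_outcome : finType;
  alice_measure : bits n -> measurement alice_outcome (2 ^ k);
  alice_message : bits n -> alice_outcome -> bits m;
  bob_outcome : finType;
  bob_measure : bits n -> bits m -> measurement bob_outcome (2 ^ k);
  bob_output : bits n -> bits m -> bob_outcome -> bool
}.

Definition error_prob (n k m : nat) (P : protocol n k m)
    (f : bits n -> bits n -> bool) (x y : bits n) : R :=
  \sum_(a : alice_outcome P)
    let msg := alice_message x a in
    \sum_(b : bob_outcome P | bob_output y msg b != f x y)
      joint_prob (effect (alice_measure P x) a)
                 (effect (bob_measure P y msg) b).

Definition error_at_most (n k m : nat) (P : protocol n k m)
    (f : bits n -> bits n -> bool) (eps : R) : Prop :=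
  forall x y : bits n, error_prob P f x y <= eps.

End Quantum.

(* Main.v *)
(* Alice's measurement is built from unitaries V_(x,i) on C^L, indexed by
   i < M = 2^m, where 2^k = M L. With a Hadamard matrix H, outcome a is the projector
   whose (i,j) block is M^-1 H_ai H_aj V_(x,i)^* V_(x,j), and Bob tests the
   transpose of the projector of his own input. On the maximally entangled state
   this accepts equal inputs with certainty, and different inputs with
   probability |S|^2 / (M^2 L), where S = \sum_i V_(x,i) V_(y,i)^* and |.| is the
   Frobenius norm. The parameters give 2 <= M eps and L^2 >= 16 n, so it suffices
   that |S|^2 <= 2 L M for all pairs of the 2^n inputs.

   For Haar random unitaries Re tr(u Z) is subgaussian with variance of order
   |Z|^2 / L, which makes the failure probability exp(- c L^2) < 2^-n. In place
   of the Haar measure, u is the endpoint of a long walk whose steps multiply by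
   c +- i s P, where c^2 + s^2 = 1 with s small and P ranges over the Pauli basis:
   a step contracts Re tr(u Z) by c, and by Parseval it contributes a variance
   s^2 |Z|^2 / L, so the contributions add up to s^2 / (1 - c^2) = 1 times
   |Z|^2 / L. No probability space is needed, since each step, each V_(x,i) and
   each codeword is chosen in turn so that an exponential potential, summed over
   all earlier codewords, is at most its average. *)
Require Import Defs.
From mathcomp Require Import all_boot all_order all_algebra.
From mathcomp Require Import all_classical all_reals all_analysis.
From mathcomp Require Import complex mxtens.
From mathcomp Require Import ring lra zify.

Set Implicit Arguments.
Unset Strict Implicit.
Unset Printing Implicit Defensive.

Import Order.TTheory GRing.Theory Num.Theory.
Import numFieldNormedType.Exports.

Local Open Scope ring_scope.

(** * Frobenius norm and the Pauli basis *)

Section Frobenius.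
Local Open Scope complex_scope.
Variable R : realType.
Local Notation C := R[i].
Local Notation Re := (@complex.Re R).

Lemma complexReD (x y : C) : Re (x + y) = Re x + Re y.
Proof. by case: x; case: y. Qed.

Lemma complexReZ (a : R) (x : C) : Re (a%:C * x) = a * Re x.
Proof. by case: x => u v /=; rewrite mul0r subr0. Qed.

Lemma complexReJ (x : C) : Re (x^*)%R = Re x.
Proof. by case: x. Qed.

Lemma complexRe_sum (I : Type) (r : seq I) (P : pred I) (F : I -> C) :
  Re (\sum_(i <- r | P i) F i) = \sum_(i <- r | P i) Re (F i).
Proof. by apply: (big_morph Re complexReD). Qed.

Lemma complexRe_ge0 (x : C) : 0 <= x -> 0 <= Re x.
Proof. by rewrite lecE => /andP[]. Qed.

Lemma complexRe_real (x : C) : 0 <= x -> (Re x)%:C = x.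
Proof. by move=> x0; rewrite RRe_real ?ger0_real. Qed.

Lemma sqr_Re_le (x : C) : Re x ^+ 2 <= Re (x * x^*%R).
Proof. by case: x => u v /=; rewrite mulrN opprK lerDl -expr2 sqr_ge0. Qed.

Lemma adjK (p q : nat) (A : 'M[C]_(p, q)) : adj (adj A) = A.
Proof. by apply/matrixP => i j; rewrite !mxE conjCK. Qed.

Lemma adjD (p q : nat) (A B : 'M[C]_(p, q)) : adj (A + B) = adj A + adj B.
Proof. by apply/matrixP => i j; rewrite !mxE rmorphD. Qed.

Lemma adjN (p q : nat) (A : 'M[C]_(p, q)) : adj (- A) = - adj A.
Proof. by apply/matrixP => i j; rewrite !mxE rmorphN. Qed.

Lemma adj0 (p q : nat) : adj (0 : 'M[C]_(p, q)) = 0.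
Proof. by apply/matrixP => i j; rewrite !mxE rmorph0. Qed.

Lemma adjZ (p q : nat) (a : C) (A : 'M[C]_(p, q)) :
  adj (a *: A) = (a^*)%R *: adj A.
Proof. by apply/matrixP => i j; rewrite !mxE rmorphM. Qed.

Lemma conj_realC (a : R) : (a%:C^*)%R = a%:C :> C.
Proof. exact: conjc_real. Qed.

Lemma adjZr (p q : nat) (a : R) (A : 'M[C]_(p, q)) :
  adj (a%:C *: A) = a%:C *: adj A.
Proof. by rewrite adjZ conj_realC. Qed.

Lemma adj_sum (p q : nat) (I : Type) (r : seq I) (P : pred I)
    (F : I -> 'M[C]_(p, q)) :
  adj (\sum_(i <- r | P i) F i) = \sum_(i <- r | P i) adj (F i).
Proof. by apply: (big_morph _ (@adjD p q)); rewrite adj0. Qed.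

Lemma adjM (p q r : nat) (A : 'M[C]_(p, q)) (B : 'M[C]_(q, r)) :
  adj (A *m B) = adj B *m adj A.
Proof. by rewrite /adj trmx_mul map_mxM. Qed.

Lemma adj1 (d : nat) : adj (1%:M : 'M[C]_d) = 1%:M.
Proof. by rewrite /adj trmx1 map_mx1. Qed.

Lemma adj_tens (m n p q : nat) (A : 'M[C]_(m, n)) (B : 'M[C]_(p, q)) :
  adj (A *t B) = adj A *t adj B.
Proof. by rewrite /adj trmx_tens map_mxT. Qed.

Lemma adj_block (m n p q : nat) (A : 'M[C]_(m, p)) (B : 'M[C]_(m, q))
    (D : 'M[C]_(n, p)) (E : 'M[C]_(n, q)) :
  adj (block_mx A B D E) = block_mx (adj A) (adj D) (adj B) (adj E).
Proof. by rewrite /adj tr_block_mx map_block_mx. Qed.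

Lemma mxtrace_adj (d : nat) (A : 'M[C]_d) : \tr (adj A) = ((\tr A)^*)%R.
Proof. by rewrite /mxtrace rmorph_sum; apply: eq_bigr => i _; rewrite !mxE. Qed.

Lemma mxtrace_adj_mul_ge0 (p q : nat) (A : 'M[C]_(p, q)) :
  0 <= \tr (adj A *m A).
Proof.
apply: sumr_ge0 => i _; rewrite !mxE; apply: sumr_ge0 => j _.
by rewrite !mxE mulrC mul_conjC_ge0.
Qed.

(** This is the square of the Frobenius norm; by [frobC] the real part discards nothing. *)
Definition frob (p q : nat) (A : 'M[C]_(p, q)) : R := Re (\tr (adj A *m A)).

Lemma frob_ge0 (p q : nat) (A : 'M[C]_(p, q)) : 0 <= frob A.
Proof. exact/complexRe_ge0/mxtrace_adj_mul_ge0. Qed.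

Lemma frobC (p q : nat) (A : 'M[C]_(p, q)) :
  (frob A)%:C = \tr (adj A *m A).
Proof. exact/complexRe_real/mxtrace_adj_mul_ge0. Qed.

Lemma frobZ (p q : nat) (a : R) (A : 'M[C]_(p, q)) :
  frob (a%:C *: A) = a ^+ 2 * frob A.
Proof.
rewrite /frob adjZr -scalemxAl -scalemxAr !mxtraceZ !complexReZ.
by rewrite mulrA expr2.
Qed.

Lemma frob0 (p q : nat) : frob (0 : 'M[C]_(p, q)) = 0.
Proof. by rewrite /frob mulmx0 mxtrace0. Qed.

Lemma frobD (p q : nat) (A B : 'M[C]_(p, q)) :
  frob (A + B) = frob A + frob B + 2 * Re (\tr (adj A *m B)).
Proof.
rewrite /frob adjD mulmxDl !mulmxDr !mxtraceD !complexReD.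
have -> : Re (\tr (adj B *m A)) = Re (\tr (adj A *m B)).
  by rewrite -complexReJ -mxtrace_adj adjM adjK.
ring.
Qed.

Definition unitary (d : nat) (U : 'M[C]_d) : Prop := adj U *m U = 1%:M.

Lemma unitaryC (d : nat) (U : 'M[C]_d) : unitary U -> U *m adj U = 1%:M.
Proof. exact: mulmx1C. Qed.

Lemma unitary1 (d : nat) : unitary (1%:M : 'M[C]_d).
Proof. by rewrite /unitary adj1 mul1mx. Qed.

Lemma unitaryM (d : nat) (U V : 'M[C]_d) :
  unitary U -> unitary V -> unitary (U *m V).
Proof.
by move=> hU hV; rewrite /unitary adjM mulmxA -(mulmxA _ _ U) hU mulmx1.
Qed.

Lemma unitary_adj (d : nat) (U : 'M[C]_d) : unitary U -> unitary (adj U).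
Proof. by move=> hU; rewrite /unitary adjK; apply: unitaryC. Qed.

Lemma frob_unitaryl (d p : nat) (U : 'M[C]_d) (A : 'M[C]_(d, p)) :
  unitary U -> frob (U *m A) = frob A.
Proof.
by move=> hU; rewrite /frob adjM mulmxA -(mulmxA _ _ U) hU mulmx1.
Qed.

Lemma frob_adj (p q : nat) (A : 'M[C]_(p, q)) : frob (adj A) = frob A.
Proof. by rewrite /frob adjK mxtrace_mulC. Qed.

Lemma frob_unitary (d : nat) (U : 'M[C]_d) : unitary U -> frob U = d%:R.
Proof.
move=> hU; rewrite /frob hU mxtrace1 -[d%:R]/(1 *+ d).
by rewrite -(rmorph_nat (real_complex R)).
Qed.

Lemma mxtrace_adj_parallelogram (p q : nat) (A B : 'M[C]_(p, q)) :
  \tr (adj (A + B) *m (A + B)) + \tr (adj (A - B) *m (A - B)) =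
  2 * (\tr (adj A *m A) + \tr (adj B *m B)).
Proof.
rewrite !adjD !adjN !mulmxDl !mulmxDr !mulNmx !mulmxN !mxtraceD !raddfN /=.
ring.
Qed.

End Frobenius.

Section UnitaryErrorBasis.
Local Open Scope complex_scope.
Variable R : realType.
Local Notation C := R[i].

(** An orthogonal basis of the d by d matrices made of Hermitian unitaries. Orthogonality is
    recorded as Parseval's identity, the form in which the walk uses it. *)
Record error_basis (d : nat) := ErrorBasis {
  eb_index : finType;
  eb_mx : eb_index -> 'M[C]_d;
  eb_card : #|eb_index| = (d ^ 2)%N;
  eb_herm : forall i, adj (eb_mx i) = eb_mx i;
  eb_invol : forall i, eb_mx i *m eb_mx i = 1%:M;
  eb_parseval : forall X : 'M[C]_d,
    \sum_i \tr (eb_mx i *m X) * ((\tr (eb_mx i *m X))^*)%R =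
    d%:R * \tr (adj X *m X)
}.

Lemma error_basis1 : error_basis 1.
Proof.
refine (@ErrorBasis 1 unit (fun=> 1%:M) _ _ _ _).
- by rewrite card_unit.
- by move=> _; apply: adj1.
- by move=> _; rewrite mulmx1.
- move=> X; rewrite big_const card_unit /= addr0 mul1mx mul1r.
  by rewrite [in RHS]mxtrace_mulC ![\tr _]big_ord1 !mxE big_ord1 !mxE.
Qed.

(* The four summands are 1 (x) P, Z (x) P, X (x) P and Y (x) P. *)
Definition pauli_double (d : nat) (I : Type) (P : I -> 'M[C]_d)
    (i : (I + I) + (I + I)) : 'M[C]_(d + d) :=
  match i with
  | inl (inl i) => block_mx (P i) 0 0 (P i)
  | inl (inr i) => block_mx (P i) 0 0 (- P i)
  | inr (inl i) => block_mx 0 (P i) (P i) 0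
  | inr (inr i) => block_mx 0 (- ('i *: P i)) ('i *: P i) 0
  end.

Lemma conj_i : ('i^*)%R = - 'i :> C.
Proof. by apply/eqP; rewrite eq_complex /= !oppr0 !eqxx. Qed.

Lemma mul_ii : 'i * 'i = -1 :> C.
Proof. by rewrite -expr2 sqr_i. Qed.

Lemma sqr_norm_iB (u v : C) :
  (- ('i * u) + 'i * v) * ((- ('i * u) + 'i * v)^*)%R =
  (v - u) * ((v - u)^*)%R.
Proof.
rewrite addrC -mulrBr; move: (v - u) => w.
by rewrite rmorphM /= conj_i mulrACA mulrN mul_ii opprK mul1r.
Qed.

(** If X has blocks A, B, D, E, the traces against the four families are those of P(A + E), P(A -
    E), P(B + D) and, up to the phase i, P(B - D). Parseval for each of these four matrices and the
    parallelogram law give Parseval for X. *)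
Lemma error_basis_double (d : nat) : error_basis d -> error_basis (d + d).
Proof.
case=> I P cardI hP iP pP.
refine (@ErrorBasis _ _ (pauli_double P) _ _ _ _).
- rewrite !card_sum cardI; lia.
- case=> [[]|[]] i /=; rewrite adj_block ?adjN ?adjZ ?adj0 hP //.
  by rewrite conj_i !scaleNr opprK.
- case=> [[]|[]] i /=; rewrite mulmx_block ?(mul0mx, mulmx0, addr0, add0r);
  rewrite ?(mulNmx, mulmxN, opprK) -?(scalemxAl, scalemxAr) ?scalerA ?mul_ii;
  by rewrite ?scaleN1r ?opprK iP -scalar_mx_block.
- move=> X; rewrite -[X]submxK.
  set A := ulsubmx X; set B := ursubmx X; set D := dlsubmx X.
  set E := drsubmx X.
  rewrite !big_sumType /=.
  have -> : \tr (adj (block_mx A B D E) *m block_mx A B D E) =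
     (\tr (adj A *m A) + \tr (adj E *m E)) +
     (\tr (adj B *m B) + \tr (adj D *m D)).
    rewrite adj_block mulmx_block mxtrace_block !mxtraceD.
    by rewrite addrACA [in RHS]addrACA [\tr (adj E *m E) + _]addrC.
  have parA := pP (A + E); have parB := pP (A - E).
  have parC := pP (B + D); have parD := pP (B - D).
  have -> : (d + d)%:R * ((\tr (adj A *m A) + \tr (adj E *m E)) +
     (\tr (adj B *m B) + \tr (adj D *m D))) =
     (d%:R * \tr (adj (A + E) *m (A + E)) +
      d%:R * \tr (adj (A - E) *m (A - E))) +
     (d%:R * \tr (adj (B + D) *m (B + D)) +
      d%:R * \tr (adj (B - D) *m (B - D))).
    rewrite -!mulrDr !mxtrace_adj_parallelogram natrD.
    move: (\tr (adj A *m A)) (\tr (adj B *m B)) => a b.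
    move: (\tr (adj D *m D)) (\tr (adj E *m E)) => c e.
    by rewrite -mulrDr !mulrA mulr_natr mulr2n.
  rewrite -{}parA -{}parB -{}parC -{}parD.
  congr (_ + _ + (_ + _)); apply: eq_bigr => i _;
    rewrite mulmx_block mxtrace_block !mul0mx ?addr0 ?add0r
            !mulmxDr ?mulNmx ?mulmxN !mxtraceD ?raddfN //=.
  + by rewrite addrC.
  + by rewrite -!scalemxAl !mxtraceZ sqr_norm_iB.
Qed.

Lemma error_basis_pow2 (l : nat) : error_basis (2 ^ l).
Proof.
elim: l => [|l IHl]; first exact: error_basis1.
by rewrite expnS mul2n -addnn; apply: error_basis_double.
Qed.

End UnitaryErrorBasis.

(** * Derandomized walk on the unitary group *)

Section RandomWalk.
Local Open Scope complex_scope.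
Variable R : realType.
Local Notation C := R[i].
Local Notation Re := (@complex.Re R).

Lemma expR_le_inv1B (y : R) : y < 1 -> expR y <= (1 - y)^-1.
Proof.
move=> y1; rewrite -[leLHS]invrK -expRN lef_pV2 ?posrE ?expR_gt0 ?subr_gt0 //.
exact: expR_ge1Dx.
Qed.

(** A bound on 2 cosh x near 0. The constant 5/8 in place of 1/2 leaves enough slack for first-order
    estimates of the exponential. *)
Lemma expRD_expRN_le (x : R) : x ^+ 2 <= 25^-1 ->
  expR x + expR (- x) <= 2 * (1 + 5 / 8 * x ^+ 2).
Proof.
wlog x0 : x / 0 <= x => [hw xs|].
  have [/hw->//|x0] := leP 0 x.
  have := hw (- x); rewrite opprK sqrrN addrC; apply=> //.
  by rewrite oppr_ge0 ltW.
move=> xs; set y := x / 2.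
have y0 : 0 <= y by rewrite /y divr_ge0.
have y1 : y <= 10^-1.
  have : x <= 5^-1 by rewrite -(@ler_pXn2r _ 2) ?nnegrE ?invr_ge0// exprVn; lra.
  rewrite /y; lra.
have -> : x = y *+ 2 by rewrite /y -mulr_natr divfK.
have eK : expR y * expR (- y) = 1 by rewrite -expRD subrr expR0.
(* Since 2 cosh 2y = (2 sinh y)^2 + 2, a linear bound on sinh y suffices. *)
have -> : expR (y *+ 2) + expR (- (y *+ 2)) = (expR y - expR (- y)) ^+ 2 + 2.
  rewrite mulr2n opprD !expRD; ring: eK.
have lo : 1 - y <= expR (- y) by apply: expR_ge1Dx.
have mono : expR (- y) <= expR y by rewrite ler_expR; lra.
have hi : expR y <= 1 + 10 / 9 * y.
  apply: le_trans (expR_le_inv1B _) _; first lra.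
  rewrite -[_^-1]mul1r ler_pdivrMr; [nra|lra].
set d := expR y - _.
have d0 : 0 <= d by rewrite subr_ge0.
have d1 : d <= 19 / 9 * y by rewrite /d; lra.
have : d ^+ 2 <= (19 / 9 * y) ^+ 2 by rewrite ler_pXn2r ?nnegrE//; lra.
rewrite exprMn -[y *+ 2]mulr_natr exprMn; have := sqr_ge0 y; lra.
Qed.

Lemma exists_le_avg (I : finType) (F : I -> R) (a : R) :
  (0 < #|I|)%N -> \sum_i F i <= #|I|%:R * a -> exists i, F i <= a.
Proof.
move=> I0 hF; have [i Fi|h] := pickP (fun i => F i <= a); first by exists i.
suff : #|I|%:R * a < \sum_i F i by rewrite ltNge hF.
rewrite mulr_natl -sumr_const; apply: ltr_sum.
  by case/card_gt0P: I0 => i _; apply/hasP; exists i; rewrite ?mem_index_enum.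
by move=> i _; rewrite ltNge h.
Qed.

(** For an involution P, with c = cos t and s = sin t, this is exp(i t P). *)
Definition rotation (d : nat) (c s : R) (P : 'M[C]_d) : 'M[C]_d :=
  c%:C *: 1%:M + ('i * s%:C) *: P.

Lemma rotation_unitary (d : nat) (c s : R) (P : 'M[C]_d) :
  c ^+ 2 + s ^+ 2 = 1 -> adj P = P -> P *m P = 1%:M ->
  unitary (rotation c s P).
Proof.
move=> cs hP PP; rewrite /unitary /rotation adjD !adjZ adj1 hP.
rewrite rmorphM /= conj_i !conj_realC mulmxDl !mulmxDr.
rewrite -!scalemxAl -!scalemxAr !scalerA mul1mx mulmx1 PP mul1mx.
rewrite addrACA [X in _ + X]addrC addrACA -!scalerDl.
have -> : - 'i * s%:C * c%:C + c%:C * ('i * s%:C) = 0 :> C.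
  by rewrite mulrC -mulrDr mulNr addNr mulr0.
rewrite scale0r addr0.
have -> : c%:C * c%:C + - 'i * s%:C * ('i * s%:C) = 1 :> C;
  last by rewrite scale1r.
have -> : - 'i * s%:C * ('i * s%:C) = s%:C * s%:C.
  by rewrite mulrACA mulNr mul_ii opprK mul1r.
by rewrite -!rmorphM -rmorphD /= -!expr2 cs.
Qed.

Lemma Re_mxtrace_rotation (d : nat) (c s : R) (P X : 'M[C]_d) :
  Re (\tr (rotation c s P *m X)) =
  c * Re (\tr X) + s * Re ('i * \tr (P *m X)).
Proof.
rewrite /rotation mulmxDl -!scalemxAl mul1mx mxtraceD !mxtraceZ.
by rewrite complexReD complexReZ mulrAC [_ * s%:C]mulrC complexReZ.
Qed.

Lemma error_basis_bessel (d : nat) (B : error_basis R d) (X : 'M[C]_d) :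
  \sum_(i : eb_index B) Re ('i * \tr (eb_mx i *m X)) ^+ 2 <= d%:R * frob X.
Proof.
apply: (@le_trans _ _ (\sum_(i : eb_index B) Re (\tr (eb_mx i *m X) *
    ((\tr (eb_mx i *m X))^*)%R))).
  apply: ler_sum => i _; apply: le_trans (sqr_Re_le _) _.
  by rewrite rmorphM /= conj_i mulrACA mulrN mul_ii opprK mul1r.
rewrite -complexRe_sum eb_parseval -frobC.
by rewrite -(rmorph_nat (real_complex R)) complexReZ.
Qed.

(** The step g is found by averaging over all basis elements and both signs of s. The signs cancel
    the first-order term, leaving a cosh. Bessel's inequality over the d^2 basis elements bounds the
    mean of its quadratic part by a multiple of s^2 |X|^2 / d, and 1 + q <= exp q puts it in the
    exponent. *)
Lemma walk_step (d : nat) (B : error_basis R d) (d_gt0 : (0 < d)%N) (c s : R)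
    (cs : c ^+ 2 + s ^+ 2 = 1) (Y : finType) (w : Y -> R) (X : Y -> 'M[C]_d) :
  (forall y, 0 <= w y) ->
  (forall y, s ^+ 2 * (d%:R * frob (X y)) <= 25^-1) ->
  exists2 g, unitary g &
    \sum_y w y * expR (Re (\tr (g *m X y))) <=
    \sum_y w y *
      expR (c * Re (\tr (X y)) + 5 / 8 * s ^+ 2 * frob (X y) / d%:R).
Proof.
move=> w0 sX.
pose rhs := \sum_y w y *
  expR (c * Re (\tr (X y)) + 5 / 8 * s ^+ 2 * frob (X y) / d%:R).
rewrite -/rhs.
have d0 : 0 < d%:R :> R by rewrite ltr0n.
pose sgn (e : bool) : R := if e then s else - s.
pose b (i : eb_index B) y := Re ('i * \tr (eb_mx i *m X y)).
have [F FE] : exists F : bool -> eb_index B -> R, forall e i,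
    F e i = \sum_y w y * expR (Re (\tr (rotation c (sgn e) (eb_mx i) *m X y))).
  by eexists => e i; reflexivity.
have card_pos : (0 < #|eb_index B|)%N by rewrite eb_card expn_gt0 d_gt0.
have FE' e i : F e i = \sum_y w y * expR (c * Re (\tr (X y)) + sgn e * b i y).
  rewrite FE; apply: eq_bigr => y _; congr (_ * expR _).
  exact: Re_mxtrace_rotation.
have [|i Gi] :=
    @exists_le_avg _ (fun i => F true i + F false i) (2 * rhs) card_pos.
  have -> : \sum_i (F true i + F false i) =
      \sum_y w y * expR (c * Re (\tr (X y))) *
      \sum_i (expR (s * b i y) + expR (- (s * b i y))).
    under [RHS]eq_bigr do rewrite mulr_sumr.
    rewrite exchange_big; apply: eq_bigr => i _ /=.
    rewrite !FE' -big_split; apply: eq_bigr => y _ /=.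
    by rewrite mulNr 2!expRD -mulrDr -mulrDr mulrA.
  rewrite /rhs !mulr_sumr; apply: ler_sum => y _.
  rewrite expRD [leRHS](_ : _ = w y * expR (c * Re (\tr (X y))) *
     (#|eb_index B|%:R * 2 * expR (5 / 8 * s ^+ 2 * frob (X y) / d%:R)));
    last by ring.
  apply: ler_wpM2l; first by rewrite mulr_ge0 ?expR_ge0.
  have bes := error_basis_bessel B (X y).
  apply: (@le_trans _ _ (\sum_i 2 * (1 + 5 / 8 * (s * b i y) ^+ 2))).
    apply: ler_sum => i _; apply: expRD_expRN_le.
    (* A single squared coefficient is at most the whole Bessel sum, so the smallness of s puts the
       argument in the range of the cosh bound. *)
    apply: le_trans (sX y); rewrite exprMn ler_wpM2l ?sqr_ge0//.
    apply: le_trans bes; rewrite (bigD1 i) //= lerDl.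
    by apply: sumr_ge0 => j _; apply: sqr_ge0.
  rewrite -mulr_sumr big_split /= sumr_const -mulr_sumr.
  under eq_bigr do rewrite exprMn.
  rewrite -mulr_sumr [_ * 2]mulrC -[leRHS]mulrA; apply: ler_wpM2l => //.
  set q := 5 / 8 * s ^+ 2 * frob (X y) / d%:R.
  apply: (@le_trans _ _ (#|eb_index B|%:R * (1 + q))); last first.
    by rewrite ler_wpM2l ?ler0n// expR_ge1Dx.
  rewrite mulrDr mulr1 lerD2l eb_card natrX.
  have -> : d%:R ^+ 2 * q = 5 / 8 * (s ^+ 2 * (d%:R * frob (X y))).
    by rewrite /q; field; rewrite gt_eqF.
  by rewrite ler_wpM2l ?divr_ge0// ler_wpM2l ?sqr_ge0.
have [e Fe] : exists e, F e i <= rhs.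
  by have [h|h] := leP (F true i) rhs; [exists true|exists false; lra].
exists (rotation c (sgn e) (eb_mx i)); last by rewrite -FE.
by apply: rotation_unitary; rewrite ?eb_herm ?eb_invol // /sgn;
  case: (e); rewrite ?sqrrN.
Qed.

(** The first T steps are chosen by induction for the contracted matrices c Z, with weights [e y]
    that pay in advance for the last step. That price does not depend on the product u of the first
    steps, because |Z u| = |Z|. The variances add up by s^2 + c^2 (1 - c^(2T)) = 1 - c^(2(T+1)). *)
Lemma walk (d : nat) (B : error_basis R d) (d_gt0 : (0 < d)%N) (c s : R)
    (cs : c ^+ 2 + s ^+ 2 = 1) (T : nat) (Y : finType)
    (w : Y -> R) (Z : Y -> 'M[C]_d) :
  (forall y, 0 <= w y) ->
  (forall y, s ^+ 2 * (d%:R * frob (Z y)) <= 25^-1) ->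
  exists2 u, unitary u &
    \sum_y w y * expR (Re (\tr (u *m Z y))) <=
    \sum_y w y * expR (c ^+ T * Re (\tr (Z y)) +
      5 / 8 * (1 - c ^+ (2 * T)) * frob (Z y) / d%:R).
Proof.
elim: T w Z => [|T IHT] w Z w0 sZ.
  exists 1%:M; first exact: unitary1.
  apply: ler_sum => y _.
  by rewrite mul1mx muln0 !expr0 subrr mulr0 !mul0r mul1r addr0.
pose e y := expR (5 / 8 * s ^+ 2 * frob (Z y) / d%:R).
have c2 : c ^+ 2 <= 1 by have := sqr_ge0 s; lra.
have [||u uU hu] := IHT (fun y => w y * e y) (fun y => c%:C *: Z y).
- by move=> y; rewrite mulr_ge0 ?expR_ge0.
- move=> y; apply: le_trans (sZ y); rewrite frobZ ler_wpM2l ?sqr_ge0//.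
  by rewrite ler_wpM2l// ler_piMl ?frob_ge0.
have frobu y : frob (Z y *m u) = frob (Z y).
  by rewrite -frob_adj adjM frob_unitaryl ?frob_adj//; apply: unitary_adj.
have [|g gU hg] := @walk_step d B d_gt0 c s cs Y w (fun y => Z y *m u) w0.
- by move=> y; rewrite frobu.
exists (u *m g); first exact: unitaryM.
apply: le_trans (le_trans _ hg) _.
  by apply: ler_sum => y _; rewrite -mulmxA mxtrace_mulC -mulmxA.
apply: le_trans (le_trans _ hu) _.
  have trE y : Re (\tr (u *m (c%:C *: Z y))) = c * Re (\tr (Z y *m u)).
    by rewrite -scalemxAr mxtraceZ complexReZ mxtrace_mulC.
  apply: ler_sum => y _.
  by rewrite frobu trE expRD -/(e y) [_ * e y]mulrC mulrA.
apply: ler_sum => y _.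
rewrite -mulrA -expRD mxtraceZ complexReZ frobZ.
rewrite le_eqVlt; apply/orP; left; apply/eqP; congr (_ * expR _).
rewrite /e mulnS exprD (exprS c T).
have -> : s ^+ 2 = 1 - c ^+ 2 by rewrite -cs; ring.
ring.
Qed.

Lemma exists_pow_le (c delta : R) : 0 <= c < 1 -> 0 < delta ->
  exists T, c ^+ T <= delta.
Proof.
move=> /andP[c0 c1] delta0.
have cvg : (c ^+ n @[n --> \oo] --> (0 : R))%classic.
  by apply: cvg_expr; rewrite ger0_norm.
have [T _ hT] := @cvgr0_norm_le _ _ _ _ _ _ cvg _ delta0.
exists T; apply: le_trans (hT T (leqnn _)); exact: ler_norm.
Qed.

(** As [Y] is finite, one step size is small enough for all [Z y], and one walk is long enough to
    bring every drift c^T Re tr Z below [delta]. *)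
Lemma exists_subgaussian_unitary (d : nat) (B : error_basis R d)
    (d_gt0 : (0 < d)%N) (delta : R) (delta_gt0 : 0 < delta) (Y : finType)
    (w : Y -> R) (Z : Y -> 'M[C]_d) :
  (forall y, 0 <= w y) ->
  exists2 u, unitary u &
    \sum_y w y * expR (Re (\tr (u *m Z y))) <=
    \sum_y w y * expR (delta + 5 / 8 * frob (Z y) / d%:R).
Proof.
move=> w0; have d0 : 0 < d%:R :> R by rewrite ltr0n.
pose bd := \sum_y d%:R * frob (Z y).
have bd0 : 0 <= bd.
  by apply: sumr_ge0 => y _; rewrite mulr_ge0 ?ler0n ?frob_ge0.
have bdy y : d%:R * frob (Z y) <= bd.
  rewrite /bd (bigD1 y) //= lerDl.
  by apply: sumr_ge0 => z _; rewrite mulr_ge0 ?ler0n ?frob_ge0.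
(* The summand 1 keeps [s2] at most 1 even if [bd] is 0; it serves likewise in the threshold
   [delta / (1 + t)] below. *)
pose s2 := (25 * (1 + bd))^-1.
have s20 : 0 < s2 by rewrite invr_gt0; lra.
have s2bd : s2 * bd <= 25^-1.
  rewrite /s2 mulrC ler_pdivrMr ?mulrA ?mulVf ?mul1r//; lra.
have s21 : s2 <= 1 by rewrite invf_le1; lra.
pose c := Num.sqrt (1 - s2); pose s := Num.sqrt s2.
have c2 : c ^+ 2 = 1 - s2 by rewrite sqr_sqrtr// subr_ge0.
have sE : s ^+ 2 = s2 by rewrite sqr_sqrtr// ltW.
have c0 : 0 <= c by apply: sqrtr_ge0.
have c1 : c < 1 by rewrite -(@ltr_pXn2r _ 2) ?nnegrE// expr1n c2; lra.
pose t := \sum_y `|Re (\tr (Z y))|.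
have t0 : 0 <= t by apply: sumr_ge0.
have [||T hT] := @exists_pow_le c (delta / (1 + t)).
- by rewrite c0 c1.
- by rewrite divr_gt0//; lra.
have cs : c ^+ 2 + s ^+ 2 = 1 by rewrite c2 sE; ring.
have [|u uU hu] := @walk d B d_gt0 c s cs T Y w Z w0.
- move=> y; rewrite sE; apply: le_trans s2bd.
  by rewrite ler_wpM2l// ltW.
exists u => //; apply: le_trans hu _; apply: ler_sum => y _.
apply: ler_wpM2l => //; rewrite ler_expR lerD//.
- have ty : Re (\tr (Z y)) <= t.
    apply: le_trans (ler_norm _) _; rewrite /t (bigD1 y) //= lerDl.
    exact: sumr_ge0.
  have cT0 : 0 <= c ^+ T by rewrite exprn_ge0.
  apply: (@le_trans _ _ (c ^+ T * (1 + t))); first by rewrite ler_wpM2l//; lra.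
  by rewrite -ler_pdivlMr//; lra.
- rewrite ler_wpM2r ?invr_ge0 ?ler0n// ler_wpM2r ?frob_ge0//.
  have := exprn_ge0 (2 * T) c0; lra.
Qed.

End RandomWalk.

(** * Codes of unitaries with small overlaps *)

Section Code.
Local Open Scope complex_scope.
Variable R : realType.
Local Notation C := R[i].
Local Notation Re := (@complex.Re R).

(** Families are indexed by all of [nat], so that partial sums make sense while a family is still
    being chosen. *)
Definition overlap (d M : nat) (V W : nat -> 'M[C]_d) : 'M[C]_d :=
  \sum_(i < M) V i *m adj (W i).

Lemma overlapS (d j : nat) (V W : nat -> 'M[C]_d) :
  overlap j.+1 V W = overlap j V W + V j *m adj (W j).
Proof. by rewrite /overlap big_ord_recr. Qed.

Lemma frob_overlapC (d M : nat) (V W : nat -> 'M[C]_d) :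
  frob (overlap M V W) = frob (overlap M W V).
Proof.
rewrite -frob_adj /overlap adj_sum.
by congr frob; apply: eq_bigr => i _; rewrite adjM adjK.
Qed.

(* Chosen so that [rate M j.+1 + 5/2 * rate M j.+1 ^+ 2 <= rate M j]: this
   absorbs the quadratic term which the choice of one more unitary adds to the
   exponent. *)
Definition rate (M j : nat) : R := 2 / (5 * (2 * M + j)%:R).

Lemma rate_step (M j : nat) : (0 < M)%N ->
  rate M j.+1 + 5 / 2 * rate M j.+1 ^+ 2 <= rate M j.
Proof.
move=> M0; rewrite /rate addnS -[(_ + j).+1%:R]natr1.
have : 0 < (2 * M + j)%:R :> R by rewrite ltr0n; lia.
move: ((2 * M + j)%:R) => u u0.
rewrite -subr_ge0.
have -> : 2 / (5 * u) - (2 / (5 * (u + 1)) + 5 / 2 * (2 / (5 * (u + 1))) ^+ 2) =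
   2 / (5 * u * (u + 1) ^+ 2) by field; rewrite !gt_eqF//; lra.
by rewrite divr_ge0// mulr_ge0 ?sqr_ge0//; lra.
Qed.

Lemma rate_gt0 (M j : nat) : (0 < M)%N -> 0 < rate M j.
Proof. by move=> M0; rewrite divr_gt0 ?mulr_gt0// ltr0n; lia. Qed.

Lemma rate_le (M j : nat) : (0 < M)%N -> rate M j <= (5 * M%:R)^-1.
Proof.
move=> M0; have M0' : 0 < M%:R :> R by rewrite ltr0n.
rewrite /rate natrD natrM; have : 0 <= j%:R :> R by rewrite ler0n.
move: (j%:R) (M%:R) M0' => v u u0 v0.
rewrite ler_pdivrMr; last lra.
rewrite mulrC ler_pdivlMr; lra.
Qed.

Lemma exists_small_overlaps (d : nat) (B : error_basis R d) (d_gt0 : (0 < d)%N)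
    (M : nat) (M_gt0 : (0 < M)%N) (delta : R) (delta_gt0 : 0 < delta)
    (Y : finType) (W : Y -> nat -> 'M[C]_d) (j : nat) :
  (forall y i, unitary (W y i)) ->
  exists2 V : nat -> 'M[C]_d, (forall i, unitary (V i)) &
    \sum_y expR (rate M j * d%:R * frob (overlap j V (W y))) <=
    #|Y|%:R * expR (j%:R * (d%:R ^+ 2 / (5 * M%:R) + delta)).
Proof.
move=> WU; have d0 : 0 < d%:R :> R by rewrite ltr0n.
elim: j => [|j [V VU hV]].
  exists (fun=> 1%:M); first by move=> _; apply: unitary1.
  rewrite mul0r expR0 mulr1 -sumr_const; apply: ler_sum => y _.
  by rewrite /overlap big_ord0 frob0 mulr0 expR0.
set t := rate M j.+1.
have t0 : 0 < t by apply: rate_gt0.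
have tM : t <= (5 * M%:R)^-1 by apply: rate_le.
pose S y := overlap j V (W y).
pose w y := expR (t * d%:R * frob (S y) + t * d%:R ^+ 2).
(* Scaled so that Re tr(u Z) is the cross term of t d |S + u W*|^2. *)
pose Z y := (2 * t * d%:R)%:C *: (adj (W y j) *m adj (S y)).
have [|u uU hu] :=
    @exists_subgaussian_unitary _ d B d_gt0 delta delta_gt0 Y w Z.
  by move=> y; apply: expR_ge0.
(* Only index [j] matters here; the later ones also get [u] so that every member is unitary. *)
pose V' i := if (i < j)%N then V i else u.
have V'j y : overlap j.+1 V' (W y) = S y + u *m adj (W y j).
  rewrite overlapS {2}/V' ltnn; congr (_ + _).
  by apply: eq_bigr => i _; rewrite /V' ltn_ord.
exists V'; first by move=> i; rewrite /V'; case: ifP.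
have frobV' y : t * d%:R * frob (overlap j.+1 V' (W y)) =
    (t * d%:R * frob (S y) + t * d%:R ^+ 2) + Re (\tr (u *m Z y)).
  rewrite V'j frobD.
  rewrite (frob_unitary (unitaryM uU (unitary_adj (WU y j)))).
  have -> : Re (\tr (u *m Z y)) =
      2 * t * d%:R * Re (\tr (adj (S y) *m (u *m adj (W y j)))).
    by rewrite -scalemxAr mxtraceZ complexReZ [in LHS]mulmxA mxtrace_mulC.
  move: (Re _) (frob _) => p q; ring.
under eq_bigr do rewrite frobV' expRD.
apply: le_trans hu _.
have -> : j.+1%:R * (d%:R ^+ 2 / (5 * M%:R) + delta) =
  j%:R * (d%:R ^+ 2 / (5 * M%:R) + delta) + (d%:R ^+ 2 / (5 * M%:R) + delta).
  by rewrite -[j.+1%:R]natr1 mulrDl mul1r.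
rewrite expRD mulrA; apply: le_trans (ler_wpM2r (expR_ge0 _) hV).
rewrite mulr_suml; apply: ler_sum => y _.
rewrite -!expRD ler_expR frobZ frob_unitaryl; last exact/unitary_adj.
rewrite frob_adj -/(S y).
have F0 : 0 <= frob (S y) by apply: frob_ge0.
have -> : 5 / 8 * ((2 * t * d%:R) ^+ 2 * frob (S y)) / d%:R =
    5 / 2 * t ^+ 2 * (d%:R * frob (S y)).
  by move: (frob _) => q; field; rewrite gt_eqF.
have h1 : t * d%:R ^+ 2 <= d%:R ^+ 2 / (5 * M%:R).
  by rewrite mulrC ler_wpM2l ?sqr_ge0.
have h2 : (t + 5 / 2 * t ^+ 2) * (d%:R * frob (S y)) <=
    rate M j * (d%:R * frob (S y)).
  by apply: ler_wpM2r; [rewrite mulr_ge0 // ltW|exact: rate_step].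
move: h1 h2; lra.
Qed.

Lemma expR1_ge2 : 2 <= expR 1 :> R.
Proof. by have := expR_ge1Dx (1 : R); lra. Qed.

(** One overlap above 2 d M would by itself contribute exp(4/15 d^2) to the potential, at the final
    rate 2/(15M). The total is at most |Y| exp(d^2/5 + n/15), so |Y| would be at least exp((d^2 -
    n)/15) >= exp n >= 2^n. *)
Lemma exists_next_codeword (d : nat) (B : error_basis R d) (d_gt0 : (0 < d)%N)
    (M : nat) (M_gt0 : (0 < M)%N) (n : nat) (n_gt0 : (0 < n)%N)
    (nd : (16 * n <= d ^ 2)%N) (Y : finType) (cardY : (#|Y| < 2 ^ n)%N)
    (W : Y -> nat -> 'M[C]_d) :
  (forall y i, unitary (W y i)) ->
  exists2 V : nat -> 'M[C]_d, (forall i, unitary (V i)) &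
    forall y, frob (overlap M V (W y)) <= 2 * d%:R * M%:R.
Proof.
move=> WU; have d0 : 0 < d%:R :> R by rewrite ltr0n.
have M0 : 0 < M%:R :> R by rewrite ltr0n.
have n0 : 0 < n%:R :> R by rewrite ltr0n.
(* The M choices lose n/15 in all, just what d^2 >= 16 n can spare. *)
pose delta : R := n%:R / (15 * M%:R).
have delta0 : 0 < delta by rewrite divr_gt0//; lra.
have [V VU hV] := exists_small_overlaps B d_gt0 M_gt0 delta0 M WU.
exists V => // y; rewrite leNgt; apply/negP => big.
have rateM : rate M M = 2 / (15 * M%:R).
  rewrite /rate natrD natrM; field; rewrite gt_eqF//; lra.
have : expR (4 / 15 * d%:R ^+ 2 : R) <=
    #|Y|%:R * expR (d%:R ^+ 2 / 5 + n%:R / 15).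
  rewrite [X in _ * expR X](_ : _ =
     M%:R * (d%:R ^+ 2 / (5 * M%:R) + delta)); last first.
    by rewrite /delta; field; rewrite gt_eqF.
  apply: le_trans hV.
  rewrite (bigD1 y) //= -[leLHS]addr0 lerD//; last first.
    by apply: sumr_ge0 => z _; apply: expR_ge0.
  rewrite ler_expR rateM.
  rewrite [leLHS](_ : _ = 2 / (15 * M%:R) * d%:R * (2 * d%:R * M%:R));
    last first.
    by field; rewrite gt_eqF.
  by rewrite ler_wpM2l ?(ltW big)// mulr_ge0 ?ltW// divr_gt0//; lra.
rewrite -ler_pdivrMr ?expR_gt0// -expRN -expRD leNgt => /negP; apply.
have nd' : 16 * n%:R <= d%:R ^+ 2 :> R by rewrite -natrX -natrM ler_nat.
apply: (@lt_le_trans _ _ (2 ^+ n)); first by rewrite -natrX ltr_nat.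
apply: (@le_trans _ _ (expR n%:R)).
  by rewrite -[n%:R]mul1r expRM_natr lerXn2r ?nnegrE ?expR_ge0// expR1_ge2.
rewrite ler_expR; lra.
Qed.

Lemma exists_code (d : nat) (B : error_basis R d) (d_gt0 : (0 < d)%N)
    (M : nat) (M_gt0 : (0 < M)%N) (n : nat) (n_gt0 : (0 < n)%N)
    (nd : (16 * n <= d ^ 2)%N) (N : nat) :
  (N <= 2 ^ n)%N ->
  exists2 V : nat -> nat -> 'M[C]_d, (forall x i, unitary (V x i)) &
    forall x y, (y < x < N)%N ->
      frob (overlap M (V x) (V y)) <= 2 * d%:R * M%:R.
Proof.
elim: N => [|N IHN] hN.
  exists (fun _ _ => 1%:M); first by move=> *; apply: unitary1.
  by move=> x y; rewrite ltn0 andbF.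
have [V VU hV] := IHN (ltnW hN).
have [|U UU hU] := @exists_next_codeword d B d_gt0 M M_gt0 n n_gt0 nd 'I_N _
  (fun y => V y) (fun y => VU y).
  by rewrite card_ord.
exists (fun x => if x == N then U else V x).
  by move=> x i; case: eqP.
move=> x y /andP[yx]; rewrite ltnS leq_eqVlt => /orP[/eqP xN|xN].
  have yN : (y < N)%N by rewrite -xN.
  by rewrite xN eqxx ltn_eqF// (hU (Ordinal yN)).
by rewrite !ltn_eqF// ?(ltn_trans yx xN)// hV// yx xN.
Qed.

Lemma exists_bits_code (d : nat) (B : error_basis R d) (d_gt0 : (0 < d)%N)
    (M : nat) (M_gt0 : (0 < M)%N) (n : nat) (n_gt0 : (0 < n)%N)
    (nd : (16 * n <= d ^ 2)%N) :
  exists2 V : bits n -> nat -> 'M[C]_d, (forall x i, unitary (V x i)) &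
    forall x y, x != y -> frob (overlap M (V x) (V y)) <= 2 * d%:R * M%:R.
Proof.
have [V VU hV] := exists_code B d_gt0 M_gt0 n_gt0 nd (leqnn _).
exists (fun x => V (enum_rank x)) => [x i|x y xy]; first exact: VU.
have rk (z : bits n) : (enum_rank z < 2 ^ n)%N.
  by rewrite -[X in (_ < X ^ _)%N]card_bool -card_tuple ltn_ord.
have [lt|lt|/val_inj/enum_rank_inj eq] := ltngtP (enum_rank x) (enum_rank y).
- by rewrite frob_overlapC hV// lt rk.
- by rewrite hV// lt rk.
- by rewrite eq eqxx in xy.
Qed.

End Code.

(** * Hadamard projectors *)

Section Protocol.
Local Open Scope complex_scope.
Variable R : realType.
Local Notation C := R[i].
Local Notation Re := (@complex.Re R).

(** Sylvester's doubling; the square condition says that the entries are signs. *)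
Lemma exists_hadamard (m : nat) :
  exists2 H : 'M[R]_(2 ^ m), (forall i j, H i j ^+ 2 = 1) &
    H^T *m H = (2 ^ m)%:R%:M.
Proof.
elim: m => [|m [H H1 HH]].
  exists (const_mx 1) => [i j|]; first by rewrite mxE expr1n.
  by apply/matrixP => i j; rewrite !mxE big_ord1 !mxE mul1r !ord1.
rewrite expnS mul2n -addnn; exists (block_mx H H H (- H)) => [i j|].
  case: (split_ordP i) => i' ->; case: (split_ordP j) => j' ->;
    rewrite ?(block_mxEul, block_mxEur, block_mxEdl, block_mxEdr);
    by rewrite ?mxE ?sqrrN H1.
have trN : (- H)^T = - H^T by apply/matrixP => i j; rewrite !mxE.
rewrite tr_block_mx mulmx_block trN !mulNmx !mulmxN opprK subrr HH.
by rewrite natrD -raddfD /= scalar_mx_block.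
Qed.

Lemma mxtrace_tens (p q : nat) (A : 'M[C]_p) (B : 'M[C]_q) :
  \tr (A *t B) = \tr A * \tr B.
Proof. by rewrite /mxtrace mulr_sum; apply: eq_bigr => i _; rewrite mxE. Qed.

Lemma tens1mx1 (p q : nat) : 1%:M *t 1%:M = 1%:M :> 'M[C]_(p * q).
Proof.
apply/matrixP => i j; rewrite !mxE -natrM mulnb.
congr (_%:R); congr nat_of_bool.
apply/andP/eqP => [[/eqP h1 /eqP h2]|-> //].
apply: (can_inj (@mxtens_unindexK p q)).
by rewrite [LHS]surjective_pairing h1 h2.
Qed.

Lemma adj_delta (p q : nat) (i : 'I_p) (j : 'I_q) :
  adj (delta_mx i j : 'M[C]_(p, q)) = delta_mx j i.
Proof. by rewrite /adj trmx_delta map_delta_mx. Qed.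

(** The block row with entries M^(-1/2) H_ai V_i. For unitary V_i it is a coisometry onto C^d,
    through which the projector of outcome a factors. *)
Definition hadamard_row (d M : nat) (H : 'M[R]_M) (V : nat -> 'M[C]_d)
    (a : 'I_M) : 'M[C]_(1 * d, M * d) :=
  (Num.sqrt M%:R)^-1%:C *:
    \sum_(i < M) (H a i)%:C *: (delta_mx 0 i *t V i).

Lemma adj_hadamard_row (d M : nat) (H : 'M[R]_M) (V : nat -> 'M[C]_d)
    (a : 'I_M) :
  adj (hadamard_row H V a) = (Num.sqrt M%:R)^-1%:C *:
    \sum_(i < M) (H a i)%:C *: (delta_mx i 0 *t adj (V i)).
Proof.
rewrite /hadamard_row adjZr adj_sum; congr (_ *: _).
by apply: eq_bigr => i _; rewrite adjZr adj_tens adj_delta.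
Qed.

Lemma sqrt_inv_sqr (M : nat) :
  (Num.sqrt M%:R)^-1%:C * (Num.sqrt M%:R)^-1%:C = (M%:R^-1 : R)%:C.
Proof. by rewrite -rmorphM /= -invfM -expr2 sqr_sqrtr ?ler0n. Qed.

(** The signs meet in pairs and cancel, so the product is the same for all a. The case V = W gives
    idempotence of the projectors, the general case the acceptance probability. *)
Lemma hadamard_row_cross (d M : nat) (H : 'M[R]_M) (V W : nat -> 'M[C]_d)
    (a : 'I_M) : (forall i j, H i j ^+ 2 = 1) ->
  hadamard_row H V a *m adj (hadamard_row H W a) =
  (M%:R^-1 : R)%:C *: (1%:M *t overlap M V W).
Proof.
move=> H1; rewrite adj_hadamard_row /hadamard_row.
rewrite -scalemxAl -scalemxAr scalerA sqrt_inv_sqr; congr (_ *: _).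
have -> : 1%:M *t overlap M V W =
    \sum_(i < M) 1%:M *t (V i *m adj (W i)) :> 'M[C]_(1 * d).
  apply/matrixP => i j; rewrite [LHS]mxE [RHS]summxE summxE mulr_sumr.
  by apply: eq_bigr => k _; rewrite [RHS]mxE.
rewrite mulmx_suml; apply: eq_bigr => i _.
rewrite mulmx_sumr (bigD1 i) //= big1 ?addr0 => [|j ji].
  rewrite -scalemxAl -scalemxAr scalerA tensmx_mul mul_delta_mx.
  rewrite -rmorphM /= -expr2 H1 scale1r; congr (_ *t _).
  by apply/matrixP => u v; rewrite !mxE !ord1.
rewrite -scalemxAl -scalemxAr tensmx_mul mul_delta_mx_0 1?eq_sym//.
by rewrite tens0mx !scaler0.
Qed.

Definition hadamard_proj (d M : nat) (H : 'M[R]_M) (V : nat -> 'M[C]_d)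
    (a : 'I_M) : 'M[C]_(M * d) :=
  adj (hadamard_row H V a) *m hadamard_row H V a.

(** Orthogonality of the columns of H removes the off-diagonal blocks, and the diagonal ones are
    V_i* V_i = 1. *)
Lemma hadamard_proj_sum (d M : nat) (H : 'M[R]_M) (V : nat -> 'M[C]_d) :
  (0 < M)%N -> H^T *m H = M%:R%:M -> (forall i, unitary (V i)) ->
  \sum_a hadamard_proj H V a = 1%:M.
Proof.
move=> M0 HH VU; rewrite /hadamard_proj.
transitivity ((M%:R^-1 : R)%:C *: \sum_a \sum_(i < M) \sum_(j < M)
   (H a i * H a j)%:C *: (delta_mx i j *t (adj (V i) *m V j)) : 'M[C]_(M * d)).
  rewrite scaler_sumr; apply: eq_bigr => a _.
  rewrite adj_hadamard_row /hadamard_row.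
  rewrite -scalemxAl -scalemxAr scalerA sqrt_inv_sqr; congr (_ *: _).
  rewrite mulmx_suml; apply: eq_bigr => i _.
  rewrite mulmx_sumr; apply: eq_bigr => j _.
  by rewrite -scalemxAl -scalemxAr scalerA tensmx_mul mul_delta_mx -rmorphM.
rewrite exchange_big /=; under eq_bigr do rewrite exchange_big /=.
have HE i j : \sum_a (H a i * H a j)%:C = (M%:R *+ (i == j) : R)%:C :> C.
  rewrite -rmorph_sum /=; congr (_%:C).
  move/matrixP/(_ i j): HH; rewrite !mxE => <-.
  by apply: eq_bigr => a _; rewrite mxE.
under eq_bigr => i _.
  under eq_bigr => j _ do rewrite -scaler_suml HE.
  rewrite (bigD1 i) //= big1 ?addr0 => [|j ji]; last first.
    by rewrite eq_sym (negPf ji) mulr0n scale0r.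
  rewrite eqxx mulr1n VU.
  over.
rewrite -scaler_sumr scalerA -rmorphM /= mulVf ?pnatr_eq0 -?lt0n// scale1r.
rewrite -[RHS]tens1mx1 [X in _ = X *t _]mx1_sum_delta.
apply/matrixP => u v; rewrite summxE [RHS]mxE summxE mulr_suml.
by apply: eq_bigr => i _; rewrite [LHS]mxE.
Qed.

Definition projector (d : nat) (P : 'M[C]_d) : Prop :=
  adj P = P /\ P *m P = P.

Lemma projector_psd (d : nat) (P : 'M[C]_d) : projector P -> psd P.
Proof.
move=> [hP PP] v; rewrite -PP -{1}hP mulmxA -adjM -mulmxA.
by rewrite -[X in 0 <= X]/(_ _ _) -trace_mx11 mxtrace_adj_mul_ge0.
Qed.

Lemma projector_tr (d : nat) (P : 'M[C]_d) : projector P -> projector P^T.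
Proof.
move=> [hP PP]; split; last by rewrite -trmx_mul PP.
by rewrite -[in RHS]hP; apply/matrixP => i j; rewrite !mxE.
Qed.

Lemma projector_compl (d : nat) (P : 'M[C]_d) :
  projector P -> projector (1%:M - P).
Proof.
move=> [hP PP]; split; first by rewrite adjD adjN adj1 hP.
by rewrite mulmxBl mul1mx mulmxBr mulmx1 PP subrr subr0.
Qed.

Lemma hadamard_proj_projector (d M : nat) (H : 'M[R]_M) (V : nat -> 'M[C]_d)
    (a : 'I_M) : (forall i j, H i j ^+ 2 = 1) -> (forall i, unitary (V i)) ->
  projector (hadamard_proj H V a).
Proof.
move=> H1 VU; rewrite /hadamard_proj; split; first by rewrite adjM adjK.
rewrite mulmxA -(mulmxA (adj _)) hadamard_row_cross//.
have -> : overlap M V V = (M%:R)%:C *: 1%:M.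
  rewrite /overlap; under eq_bigr do rewrite unitaryC//.
  by rewrite sumr_const card_ord rmorph_nat scaler_nat.
have M0 : M%:R != 0 :> R.
  by rewrite pnatr_eq0 -lt0n; apply: leq_ltn_trans (ltn_ord a).
have -> : (M%:R^-1 : R)%:C *: (1%:M *t (M%:R%:C *: 1%:M)) = 1%:M
    :> 'M[C]_(1 * d).
  rewrite -[RHS]tens1mx1; apply/matrixP => i j; rewrite !mxE.
  by rewrite mulrCA; congr (_ * _); rewrite mulrA -rmorphM /= mulVf// mul1r.
by rewrite mulmx1.
Qed.

(** By cyclicity of the trace, tr(A* A B* B) = |A B*|^2, and A B* is the cross product of the two
    block rows. *)
Lemma Re_mxtrace_hadamard_proj (d M : nat) (H : 'M[R]_M)
    (V W : nat -> 'M[C]_d) (a : 'I_M) : (forall i j, H i j ^+ 2 = 1) ->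
  Re (\tr (hadamard_proj H V a *m hadamard_proj H W a)) =
  M%:R^-1 ^+ 2 * frob (overlap M V W).
Proof.
move=> H1; rewrite /hadamard_proj mulmxA mxtrace_mulC -!mulmxA.
set A := hadamard_row H V a; set B := hadamard_row H W a.
transitivity (frob (A *m adj B)).
  by rewrite /frob adjM adjK -mulmxA.
rewrite hadamard_row_cross// frobZ; congr (_ * _).
by rewrite /frob adj_tens tensmx_mul mxtrace_tens adj1 mulmx1 mxtrace1 mul1r.
Qed.

Lemma exists_bits_ord (m : nat) : exists h : bits m -> 'I_(2 ^ m), bijective h.
Proof.
have card_bits : #|{: bits m}| = (2 ^ m)%N by rewrite card_tuple card_bool.
exists (fun a => cast_ord card_bits (enum_rank a)).
apply: bij_comp; last exact: enum_rank_bij.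
by exists (cast_ord (esym card_bits)); [apply: cast_ordK|apply: cast_ordKV].
Qed.

Lemma exists_projectors (n m l : nat) :
  (0 < n)%N -> (16 * n <= (2 ^ l) ^ 2)%N ->
  exists A : bits n -> bits m -> 'M[C]_(2 ^ (m + l)),
    [/\ forall x a, projector (A x a),
        forall x, \sum_a A x a = 1%:M &
        forall x y, x != y ->
          \sum_a Re (\tr (A x a *m A y a)) <= 2 * (2 ^ l)%:R].
Proof.
move=> n0 nl; rewrite expnD.
have [H H1 HH] := exists_hadamard m.
have M0 : (0 < 2 ^ m)%N by rewrite expn_gt0.
have d0 : (0 < 2 ^ l)%N by rewrite expn_gt0.
have [V VU hV] := exists_bits_code (error_basis_pow2 R l) d0 M0 n0 nl.
have [h h_bij] := exists_bits_ord m.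
exists (fun x a => hadamard_proj H (V x) (h a)); split.
- by move=> x a; apply: hadamard_proj_projector.
- move=> x; rewrite -(hadamard_proj_sum M0 HH (VU x)).
  by rewrite [RHS](reindex h) //; apply: onW_bij.
move=> x y xy; under eq_bigr do rewrite Re_mxtrace_hadamard_proj//.
rewrite sumr_const card_tuple card_bool.
have M0' : 0 < (2 ^ m)%:R :> R by rewrite ltr0n.
(* The M outcomes contribute M^(-2) |S|^2 each, hence |S|^2 / M <= 2 d in all. *)
rewrite -[leLHS]mulr_natl mulrA expr2 mulrA divff ?gt_eqF// mul1r mulrC.
by rewrite ler_pdivrMr// hV.
Qed.

(** On the maximally entangled vector E (x) F has expectation 2^(-k) times the sum of E_ij F_ij.
    This transpose is why Bob measures transposed projectors. *)
Lemma joint_probE (k : nat) (E F : 'M[C]_(2 ^ k)) :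
  joint_prob E F = (2 ^+ k)^-1 * Re (\tr (E *m F^T)).
Proof.
rewrite /joint_prob /epr adjZr -!(scalemxAl, scalemxAr) scalerA.
rewrite -rmorphM /= -invfM -expr2 sqr_sqrtr ?exprn_ge0// mxE complexReZ.
congr (_ * Re _).
rewrite adj_sum mulmx_suml mulmx_suml summxE; apply: eq_bigr => i _.
rewrite mulmx_sumr summxE [RHS]mxE; apply: eq_bigr => j _.
rewrite [RHS](_ : _ = E i j * F i j); last by rewrite mxE.
have h : adj (ket R i *t ket R i) *m (E *t F) *m (ket R j *t ket R j) =
    (row i E *m ket R j) *t (row i F *m ket R j).
  by rewrite adj_tens !tensmx_mul /ket !adj_delta -!rowE.
have := congr1 (fun X : 'M[C]_1 => X 0 0) h; rewrite /= => ->.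
by rewrite mxE /ket -!colE !mxE.
Qed.

End Protocol.

(** * The protocol *)

Section Main.
Local Open Scope complex_scope.
Variable R : realType.
Local Notation C := R[i].
Local Notation Re := (@complex.Re R).

Definition bool_measurement (d : nat) (P : 'M[C]_d) (hP : projector P) :
  measurement R bool d.
Proof.
refine (@Measurement _ _ _ (fun b => if b then P else 1%:M - P) _ _).
- by case; apply: projector_psd => //; apply: projector_compl.
- by rewrite big_bool /= addrC subrK.
Defined.

Lemma exists_eq_protocol (n m l : nat) (eps : R) :
  (0 < n)%N -> (16 * n <= (2 ^ l) ^ 2)%N -> 0 <= eps -> 2 <= 2 ^+ m * eps ->
  exists P : protocol R n (m + l) m, error_at_most P (@EQ n) eps.
Proof.
move=> n0 nl eps0 Meps.
have [A [Aproj Asum Aerr]] := exists_projectors R m n0 nl.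
pose alice x := Measurement (fun a => projector_psd (Aproj x a)) (Asum x).
pose bob y a := bool_measurement (projector_tr (Aproj y a)).
exists (@Protocol R n (m + l) m _ alice (fun _ a => a)
          bool bob (fun _ _ b => b)).
move=> x y; rewrite /error_prob /= /EQ.
under eq_bigr => a _.
  rewrite big_mkcond big_bool /= !joint_probE !trmxK.
  over.
have [<-|xy] := eqVneq x y.
  (* On equal inputs Bob errs only through the complement of Alice's own projector, and P (1 - P) =
     0. *)
  rewrite big1// => a _ /=.
  rewrite linearB /= trmx1 trmxK mulmxBr mulmx1 (Aproj x a).2 subrr mxtrace0.
  by rewrite mulr0 addr0.
rewrite /=; under eq_bigr do rewrite addr0.
rewrite -mulr_sumr exprD.
apply: le_trans (ler_wpM2l _ (Aerr _ _ xy)) _.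
  by rewrite invr_ge0 mulr_ge0 ?exprn_ge0.
have m0 : 0 < 2 ^+ m :> R by rewrite exprn_gt0.
have l0 : 0 < 2 ^+ l :> R by rewrite exprn_gt0.
(* Distinct inputs: the error is at most 2^(-m-l) times 2 * 2^l, that is 2 / 2^m. *)
rewrite natrX invfM [_^-1 * _^-1]mulrC mulrACA -mulrA.
rewrite [leLHS](_ : _ = 2 / 2 ^+ m); last by field; rewrite !gt_eqF.
by rewrite ler_pdivrMr// mulrC.
Qed.

Lemma le_log2 (x y : R) : 0 < x -> x <= y -> log2 x <= log2 y.
Proof.
move=> x0 xy; rewrite /log2 ler_wpM2r ?invr_ge0 ?ln_ge0 ?ler1n//.
by rewrite ler_ln ?posrE//; apply: lt_le_trans xy.
Qed.

Lemma log2_le_nat (x : R) (p : nat) : 0 < x -> (log2 x <= p%:R) = (x <= 2 ^+ p).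
Proof.
move=> x0; rewrite /log2 ler_pdivrMr ?ln_gt0 ?ltr1n// mulr_natl -lnXn//.
by rewrite ler_ln ?posrE ?exprn_gt0.
Qed.

(** With p and q the two ceilings, m = p + 1 and l = q + 3 - p. Then 2^q >= sqrt n / eps and 2^p < 2
    / eps give 2^l = 8 * 2^q / 2^p > 4 sqrt n. *)
Lemma qubit_counts (n : nat) (eps : R) :
  (0 < n)%N -> 0 < eps -> eps < 1 / 2 ->
  exists m l : nat,
    [/\ m%:Z = Num.ceil (log2 (1 / eps)) + 1,
        (m + l)%:Z = Num.ceil (log2 (Num.sqrt n%:R / eps)) + 4,
        2 <= 2 ^+ m * eps &
        (16 * n <= (2 ^ l) ^ 2)%N].
Proof.
move=> n0 e0 e1.
set a := log2 (1 / eps); set b := log2 (Num.sqrt n%:R / eps).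
have ie0 : 0 < 1 / eps by rewrite divr_gt0.
have sn1 : 1 <= Num.sqrt n%:R :> R by rewrite -[leLHS]sqrtr1 ler_wsqrtr ?ler1n.
have sn0 : 0 < Num.sqrt n%:R :> R by apply: lt_le_trans sn1.
have sne0 : 0 < Num.sqrt n%:R / eps by rewrite divr_gt0.
have a0 : 0 <= a.
  rewrite divr_ge0 ?ln_ge0 ?ler1n// ler_pdivlMr//; lra.
have ab : a <= b.
  by apply: le_log2 => //; apply: ler_wpM2r => //; rewrite invr_ge0 ltW.
have [p pE] : exists p : nat, Num.ceil a = p%:Z.
  exists `|Num.ceil a|%N; rewrite gez0_abs// ceil_ge0; lra.
have [q qE] : exists q : nat, Num.ceil b = q%:Z.
  exists `|Num.ceil b|%N; rewrite gez0_abs// ceil_ge0; lra.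
have pq : (p <= q)%N by rewrite -lez_nat -pE -qE; apply: le_ceil.
have ap : a <= p%:R by have := ceil_ge a; rewrite pE.
have bq : b <= q%:R by have := ceil_ge b; rewrite qE.
have pa : p%:R < a + 1.
  by have /andP[] := ceil_itv a; rewrite pE rmorphB /=; lra.
(* The natural subtraction is exact because [a <= b] gives [p <= q]. *)
exists p.+1, (q + 3 - p)%N; split.
- by rewrite pE -addn1 PoszD.
- rewrite qE -PoszD; congr Posz.
  by rewrite addSn subnKC ?(leq_trans pq) ?leq_addr// -addnS.
- move: ap; rewrite log2_le_nat// ler_pdivrMr// exprS -mulrA; lra.
- have p2 : 2 ^+ p * eps < 2.
    (* For positive p, minimality of the ceiling says that p - 1 is still below log(1/eps); for p =
       0 the bound is just eps < 2. *)
    case: p {pE pq ap} pa => [|p] pa; first by rewrite expr0; lra.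
    have : ~~ (a <= p%:R) by rewrite -ltNge; move: pa; rewrite -natr1; lra.
    rewrite log2_le_nat// -ltNge ltr_pdivlMr// exprS -mulrA; lra.
  have q2 : Num.sqrt n%:R <= 2 ^+ q * eps.
    by move: bq; rewrite log2_le_nat// ler_pdivrMr.
  have L : 4 * Num.sqrt n%:R <= 2 ^+ (q + 3 - p) :> R.
    have E : 2 ^+ (q + 3 - p) * 2 ^+ p = 2 ^+ q * 8 :> R.
      rewrite -exprD subnK; last by rewrite (leq_trans pq) ?leq_addr.
      by rewrite exprD; congr (_ * _); ring.
    set u := 2 ^+ (q + 3 - p) in E *.
    have u0 : 0 < u by rewrite exprn_gt0.
    have : u * (2 ^+ p * eps) < u * 2 by rewrite ltr_pM2l.
    rewrite mulrA E -mulrA mulrCA; lra.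
  rewrite -(ler_nat R) natrM !natrX -[n%:R]sqr_sqrtr ?ler0n//.
  have -> : 16 * Num.sqrt n%:R ^+ 2 = (4 * Num.sqrt n%:R) ^+ 2 :> R by ring.
  by rewrite lerXn2r ?nnegrE ?exprn_ge0// mulr_ge0// ltW.
Qed.

End Main.

Theorem theorem1p13 (R : realType) (n : nat) (eps : R)
    (n_gt0 : (0 < n)%N) (eps_gt0 : 0 < eps) (eps_lt : eps < 1 / 2) :
  exists (k m : nat) (P : protocol R n k m),
    [/\ m%:Z = Num.ceil (log2 (1 / eps)) + 1,
        k%:Z = Num.ceil (log2 (Num.sqrt n%:R / eps)) + 4 &
        error_at_most P (@EQ n) eps].
Proof.
have [m [l [mE kE Meps nl]]] := qubit_counts n_gt0 eps_gt0 eps_lt.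
have [P hP] := exists_eq_protocol n_gt0 nl (ltW eps_gt0) Meps.
by exists (m + l)%N, m, P.
Qed.
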